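(* Let $\Gamma$ be a group such that $\mathbb Z[\Gamma]$ is Noetherian and let $G$ be a dimension $\Gamma$-group, with a generating interval $D$, satisfying (SDP$_\Delta$) for some subgroup $\Delta$ of $\Gamma$ such that $\Delta\subseteq\mathrm{Stab}(G)$. Then $(G,D)$ has an ordered $\Gamma$-group extension $(H,u)$ by $(\mathbb Z[\Gamma/\overline\Delta],\overline\Delta)$, where $\overline\Delta$ is the normal closure of $\Delta$ in $\Gamma$, such that $H$ satisfies (SDP$_{\overline\Delta}$) and such that $\overline\Delta\subseteq\mathrm{Stab}(H)$.
   Context: Ordered groups. $\mathbb Z^+[\Gamma]\subseteq\mathbb Z[\Gamma]$ is the set of elements with all coefficients nonnegative. An ordered $\Gamma$-group is a left $\mathbb Z[\Gamma]$-module $G$ with a partial order such that $g_1\ge g_2$ implies $g_1+h\ge g_2+h$ and $\gamma g_1\ge\gamma g_2$ for $\gamma\in\Gamma$; $G^+=\{x\ge0\}$. $G$ is directed if any two elements have a common upper bound. $\mathrm{Stab}(G)=\{\gamma\in\Gamma:\gamma x=x\ \forall x\in G\}$. An order-unit is $u\in G^+$ such that for every $x\in G$ there is a nonzero $a\in\mathbb Z^+[\Gamma]$ with $x\le au$. A generating interval is a subset $D\subseteq G^+$ containing $0$ which is upwards directed, convex ($x\le z\le y$, $x,y\in D$ implies $z\in D$), and such that every element of $G^+$ is a finite sum of elements $ad$, $a\in\mathbb Z^+[\Gamma]$, $d\in D$. $[0,u]=\{x:0\le x\le u\}$. For a subgroup $\Delta$, $\mathbb Z[\Gamma/\Delta]$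 is the permutation module on left cosets, ordered with cone $\mathbb Z^+[\Gamma/\Delta]$ and with order-unit the coset $\Delta$; $\pi_\Delta:\mathbb Z[\Gamma]\to\mathbb Z[\Gamma/\Delta]$ is the left module map $1\mapsto\Delta$. (SDP$_\Delta$) for a directed ordered $\Gamma$-group $G$: if $\sum_{i=1}^n a_ix_i=0$ with $a_i\in\mathbb Z[\Gamma]$, $x_i\in G^+$, then there are a positive integer $m$, $b_{ij}\in\mathbb Z^+[\Gamma]$, $y_j\in G^+$ with $x_i=\sum_{j=1}^m b_{ij}y_j$ for all $i$ and $\sum_{i=1}^n\pi_\Delta(a_ib_{ij})=0$ for all $j$. A dimension $\Gamma$-group is a directed ordered $\Gamma$-group satisfying (SDP$_\Delta$) for some subgroup $\Delta\subseteq\mathrm{Stab}(G)$. Extensions. For ordered $\Gamma$-groups $G,H,K$, with $D$ a generating interval of $G$ and $u,v$ order-units of $H,K$, $(H,u)$ is an ordered $\Gamma$-group extension of $(G,D)$ by $(K,v)$ if there are order-preserving $\mathbb Z[\Gamma]$-homomorphisms $i:G\to H$ injective and $p:H\to K$ surjective with $i(G)=\ker p$, $i^{-1}(H^+)=G^+$, $p(H^+)=K^+$, $p(u)=v$, and $i^{-1}([0,u])=D$. *)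

(* Defs.v *)
From HB Require Import structures.
From mathcomp Require Import all_boot all_order all_algebra.
From mathcomp Require Import boolp classical_sets.
From mathcomp Require Import finmap.
From mathcomp Require Import monalg.

Set Implicit Arguments.
Unset Strict Implicit.
Unset Printing Implicit Defensive.

Import Order.TTheory GRing.Theory Num.Theory.

Local Open Scope fset_scope.
Local Open Scope classical_set_scope.
Local Open Scope ring_scope.

(* Bilinear extension of a map act : Gamma -> X -> X to integral combinations. *)
Section Convolution.
Context {T X : choiceType} (act : T -> X -> X).
Implicit Types (a b : {malg int[T]}) (f g : {malg int[X]}).

Definition conv a f : {malg int[X]} :=
  \sum_(k <- msupp a) \sum_(x <- msupp f) << a@_k * f@_x *g act k x >>.

Lemma convw (d1 : {fset T}) (d2 : {fset X}) a f :
  fsubset (msupp a) d1 -> fsubset (msupp f) d2 ->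
  conv a f = \sum_(k <- d1) \sum_(x <- d2) << a@_k * f@_x *g act k x >>.
Proof.
move=> le1 le2; rewrite /conv (big_fset_incl _ le1) /=.
  apply/eq_bigr => k _; apply/big_fset_incl => // x _ /mcoeff_outdom ->.
  by rewrite mulr0 monalgU0.
move=> k _ /mcoeff_outdom ak0.
by rewrite big1 // => x _; rewrite ak0 mul0r monalgU0.
Qed.

Lemma convDl f : {morph conv^~ f : a b / a + b}.
Proof.
move=> a b /=.
rewrite (convw (msuppD_le a b) (fsubset_refl (msupp f))).
rewrite (convw (fsubsetUl (msupp a) (msupp b)) (fsubset_refl (msupp f))).
rewrite (convw (fsubsetUr (msupp a) (msupp b)) (fsubset_refl (msupp f))).
rewrite -big_split /=; apply/eq_bigr => k _.
rewrite -big_split /=; apply/eq_bigr => x _.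
by rewrite mcoeffD mulrDl monalgUD.
Qed.

Lemma convDr a : {morph conv a : f g / f + g}.
Proof.
move=> f g /=.
rewrite (convw (fsubset_refl (msupp a)) (msuppD_le f g)).
rewrite (convw (fsubset_refl (msupp a)) (fsubsetUl (msupp f) (msupp g))).
rewrite (convw (fsubset_refl (msupp a)) (fsubsetUr (msupp f) (msupp g))).
rewrite -big_split /=; apply/eq_bigr => k _.
rewrite -big_split /=; apply/eq_bigr => x _.
by rewrite mcoeffD mulrDr monalgUD.
Qed.

Lemma conv0l f : conv 0 f = 0.
Proof. by rewrite /conv msupp0 big_seq_fset0. Qed.

Lemma conv0r a : conv a 0 = 0.
Proof. by rewrite /conv big1 // => k _; rewrite msupp0 big_seq_fset0. Qed.

Lemma convUU (m n : int) k x :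
  conv << m *g k >> << n *g x >> = << m * n *g act k x >>.
Proof.
by rewrite (convw (@msuppU_le _ _ k m) (@msuppU_le _ _ x n))
  !big_seq_fset1 !mcoeffUU.
Qed.

Lemma conv_suml I (r : seq I) (F : I -> {malg int[T]}) f :
  conv (\sum_(i <- r) F i) f = \sum_(i <- r) conv (F i) f.
Proof. exact: (big_morph (conv^~ f) (convDl f) (conv0l f)). Qed.

Lemma conv_sumr I (r : seq I) (F : I -> {malg int[X]}) a :
  conv a (\sum_(i <- r) F i) = \sum_(i <- r) conv a (F i).
Proof. exact: (big_morph (conv a) (convDr a) (conv0r a)). Qed.

Lemma conv1 (e : T) : (forall x, act e x = x) -> forall f, conv << e >> f = f.
Proof.
move=> act1 f; rewrite [in LHS](monalgE f) conv_sumr [RHS]monalgE.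
by apply/eq_bigr => x _; rewrite convUU mul1r act1.
Qed.

End Convolution.

Lemma convA (T X : choiceType) (op : T -> T -> T) (act : T -> X -> X) :
  (forall k l x, act k (act l x) = act (op k l) x) ->
  forall a b f, conv act a (conv act b f) = conv act (conv op a b) f.
Proof.
move=> actA a b f.
rewrite (monalgE a) !conv_suml; apply/eq_bigr => k _.
rewrite (monalgE b) conv_suml !conv_sumr conv_suml; apply/eq_bigr => l _.
rewrite (monalgE f) !conv_sumr; apply/eq_bigr => x _.
by rewrite !convUU mulrA actA.
Qed.

Section GroupRing.
Variable Gamma : groupType.

Definition group_ring : Type := {malg int[Gamma]}.

HB.instance Definition _ := GRing.Zmodule.on group_ring.

Definition gr_mul : group_ring -> group_ring -> group_ring :=
  conv (fun g h : Gamma => (g * h)%g).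

Definition gr_of (g : Gamma) : group_ring := << g >>.

Lemma gr_mulA : associative gr_mul.
Proof.
move=> a b c; apply: (@convA Gamma Gamma (fun g h : Gamma => (g * h)%g)).
by move=> k l x; rewrite mulgA.
Qed.

Lemma gr_mul1 : left_id (gr_of 1%g) gr_mul.
Proof. by apply: conv1 => g; rewrite mul1g. Qed.

Lemma gr_mulr1 : right_id (gr_of 1%g) gr_mul.
Proof.
move=> a; rewrite /gr_mul [in LHS](monalgE a) conv_suml [RHS]monalgE.
by apply/eq_bigr => k _; rewrite convUU mulr1 mulg1.
Qed.

Lemma gr_mulDl : left_distributive gr_mul +%R.
Proof. by move=> a b c; apply: convDl. Qed.

Lemma gr_mulDr : right_distributive gr_mul +%R.
Proof. by move=> a b c; apply: convDr. Qed.

Lemma gr_oner_neq0 : gr_of 1%g != 0.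
Proof. by rewrite monalgU_eq0. Qed.

HB.instance Definition _ := GRing.Zmodule_isNzRing.Build group_ring
  gr_mulA gr_mul1 gr_mulr1 gr_mulDl gr_mulDr gr_oner_neq0.

(* Z^+[Gamma] *)
Definition gr_pos : set group_ring := [set a | forall g : Gamma, 0 <= mcoeff g a].

End GroupRing.

Section Noetherian.
Variable R : pzRingType.

Definition left_ideal (I : set R) : Prop :=
  [/\ I 0, (forall x y, I x -> I y -> I (x + y)) &
      (forall a x, I x -> I (a * x))].

Definition fin_generated_left_ideal (I : set R) : Prop :=
  exists n (s : 'I_n -> R),
    I = range (fun a : 'I_n -> R => \sum_i a i * s i).

Definition left_noetherian : Prop :=
  forall I, left_ideal I -> fin_generated_left_ideal I.

End Noetherian.

(* Right ideals of R are left ideals of the converse ring R^c. *)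
Definition noetherian (R : pzRingType) : Prop :=
  left_noetherian R /\ left_noetherian R^c.

Section Subgroups.
Variable Gamma : groupType.
Implicit Types (A N : set Gamma).

Definition subgroup A : Prop := group_closed [in A].

Definition normal_subgroup N : Prop :=
  subgroup N /\ forall g x, N x -> N (x ^ g)%g.

Definition normal_closure A : set Gamma := smallest normal_subgroup A.

(* translate g A = g A makes sense for every subset A, so lcoset A needs no proof
   that A is a subgroup; it is Gamma / A when A is one. *)
Definition translate (g : Gamma) A : set Gamma := [set (g * h)%g | h in A].

Lemma translate1 A : translate 1%g A = A.
Proof.
rewrite /translate; under eq_imagel do rewrite mul1g.
exact: image_id.
Qed.

Lemma translateM g h A : translate g (translate h A) = translate (g * h)%g A.
Proof.
rewrite /translate image_comp; apply: eq_imagel => x _ /=.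
by rewrite mulgA.
Qed.

Definition lcosets A : set (set Gamma) := range (translate^~ A).

Definition lcoset A : Type := set_type (lcosets A).

HB.instance Definition _ A := Choice.on (lcoset A).

Lemma lcoset_subproof A g : translate g A \in lcosets A.
Proof. by apply: mem_set; exists g. Qed.

Definition lcoset_of A g : lcoset A := SigSub (lcoset_subproof A g).

Lemma lcoset_act_subproof A g (C : lcoset A) :
  translate g (\val C) \in lcosets A.
Proof.
case: C => C /= /set_mem[h _ <-]; apply: mem_set.
by exists (g * h)%g => //; rewrite translateM.
Qed.

Definition lcoset_act A g (C : lcoset A) : lcoset A :=
  SigSub (lcoset_act_subproof g C).

Lemma lcoset_act1 A (C : lcoset A) : lcoset_act 1%g C = C.
Proof. by apply: val_inj; rewrite /= translate1. Qed.

Lemma lcoset_actM A g h (C : lcoset A) :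
  lcoset_act g (lcoset_act h C) = lcoset_act (g * h)%g C.
Proof. by apply: val_inj; rewrite /= translateM. Qed.

End Subgroups.

HB.mixin Record isOrderedGammaGroup (Gamma : groupType) G
    of Num.POrderedZmodule G & GRing.Lmodule (group_ring Gamma) G := {
  og_lerD2r : forall z x y : G, x <= y -> x + z <= y + z;
  og_lerZ : forall (g : Gamma) (x y : G),
    x <= y -> gr_of g *: x <= gr_of g *: y
}.

#[short(type="orderedGammaGroupType")]
HB.structure Definition OrderedGammaGroup (Gamma : groupType) :=
  { G of Num.POrderedZmodule G & GRing.Lmodule (group_ring Gamma) G
       & isOrderedGammaGroup Gamma G }.

Section PermutationModule.
Context {Gamma : groupType}.
Variable A : set Gamma.

Definition perm_module : Type := {malg int[lcoset A]}.

HB.instance Definition _ := GRing.Zmodule.on perm_module.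

Definition perm_scale : group_ring Gamma -> perm_module -> perm_module :=
  conv (@lcoset_act Gamma A).

Lemma perm_scaleA a b f :
  perm_scale a (perm_scale b f) = perm_scale (a * b) f.
Proof. by apply: convA => k l C; apply: lcoset_actM. Qed.

Lemma perm_scale1 : left_id 1 perm_scale.
Proof. by apply: conv1 => C; apply: lcoset_act1. Qed.

Lemma perm_scaleDr : right_distributive perm_scale +%R.
Proof. by move=> a f g; apply: convDr. Qed.

Lemma perm_scaleDl f : {morph perm_scale^~ f : a b / a + b}.
Proof. by move=> a b; apply: convDl. Qed.

HB.instance Definition _ := GRing.Zmodule_isLmodule.Build (group_ring Gamma)
  perm_module perm_scaleA perm_scale1 perm_scaleDr perm_scaleDl.

Definition perm_le (f g : perm_module) : bool :=
  `[< forall C : lcoset A, mcoeff C f <= mcoeff C g >].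

Lemma perm_le_refl : reflexive perm_le.
Proof. by move=> f; apply/asboolP. Qed.

Lemma perm_le_anti : antisymmetric perm_le.
Proof.
move=> f g /andP[/asboolP fg /asboolP gf]; apply/malgP => C.
by apply/eqP; rewrite eq_le fg gf.
Qed.

Lemma perm_le_trans : transitive perm_le.
Proof.
move=> g f h /asboolP fg /asboolP gh; apply/asboolP => C.
exact: le_trans (fg C) (gh C).
Qed.

HB.instance Definition _ := Order.Le_isPOrder.Build ring_display perm_module
  perm_le_refl perm_le_anti perm_le_trans.

Lemma perm_leP (f g : perm_module) :
  reflect (forall C : lcoset A, mcoeff C f <= mcoeff C g) (f <= g).
Proof. exact: asboolP. Qed.

Lemma perm_lerD2r (h f g : perm_module) : f <= g -> f + h <= g + h.
Proof.
by move=> /perm_leP fg; apply/perm_leP => C; rewrite !mcoeffD lerD2r.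
Qed.

Lemma perm_lerZ (g : Gamma) (x y : perm_module) :
  x <= y -> gr_of g *: x <= gr_of g *: y.
Proof.
move=> /perm_leP xy; apply/perm_leP => C.
have coefE f : mcoeff C (gr_of g *: f : perm_module) =
    mcoeff (lcoset_act g^-1%g C) f.
  rewrite /GRing.scale /= /perm_scale [in LHS](monalgE f) conv_sumr.
  rewrite [in RHS](monalgE f) !raddf_sum; apply/eq_bigr => B _.
  rewrite convUU /= !mcoeffU mul1r; congr (_ *+ nat_of_bool _).
  apply/eqP/eqP => [<-|->].
    by rewrite lcoset_actM mulVg lcoset_act1.
  by rewrite lcoset_actM mulgV lcoset_act1.
by rewrite !coefE.
Qed.

HB.instance Definition _ := isOrderedGammaGroup.Build Gamma perm_module
  perm_lerD2r perm_lerZ.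

Definition perm_unit : perm_module := << lcoset_of A 1%g >>.

(* The left module map Z[Gamma] -> Z[Gamma / A] sending 1 to the coset A. *)
Definition perm_proj (a : group_ring Gamma) : perm_module := a *: perm_unit.

End PermutationModule.

Section OrderedGammaGroups.
Context {Gamma : groupType}.
Implicit Types (G H K : orderedGammaGroupType Gamma) (Delta : set Gamma).

Definition pos_cone G : set G := [set x | 0 <= x].
Arguments pos_cone G : clear implicits.

Definition order_interval G (u : G) : set G := [set x | 0 <= x <= u].

Definition directed G : Prop :=
  forall x y : G, exists z, x <= z /\ y <= z.

Definition stab G : set Gamma := [set g | forall x : G, gr_of g *: x = x].

Definition order_unit G (u : G) : Prop :=
  0 <= u /\
  forall x : G, exists a : group_ring Gamma, [/\ gr_pos a, a != 0 & x <= a *: u].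

Definition generating_interval G (D : set G) : Prop :=
  [/\ D `<=` pos_cone G,
      D 0,
      forall x y, D x -> D y -> exists z, [/\ D z, x <= z & y <= z],
      forall x y z, D x -> D y -> x <= z -> z <= y -> D z &
      forall x : G, 0 <= x ->
        exists n (a : 'I_n -> group_ring Gamma) (d : 'I_n -> G),
          [/\ forall i, gr_pos (a i), forall i, D (d i) &
              x = \sum_i a i *: d i]].

(* Directedness is a separate condition; it holds in every ordered group with
   an order-unit, see order_unit_directed. *)
Definition SDP Delta G : Prop :=
  forall n (a : 'I_n -> group_ring Gamma) (x : 'I_n -> G),
    (forall i, 0 <= x i) -> \sum_i a i *: x i = 0 ->
    exists m (b : 'I_n -> 'I_m -> group_ring Gamma) (y : 'I_m -> G),
      [/\ (0 < m)%N,
          (forall i j, gr_pos (b i j)) /\ (forall j, 0 <= y j),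
          forall i, x i = \sum_j b i j *: y j &
          forall j, \sum_i perm_proj Delta (a i * b i j) = 0].

Definition dimension_group G : Prop :=
  directed G /\
  exists Delta, [/\ subgroup Delta, Delta `<=` stab G & SDP Delta G].

(* (H, u) is an ordered Gamma-group extension of (G, D) by (K, v). *)
Definition is_extension G (D : set G) K (v : K) H (u : H) : Prop :=
  [/\ generating_interval D, order_unit u, order_unit v &
  exists (i : {linear G -> H}) (p : {linear H -> K}),
    [/\ {homo i : x y / x <= y} /\ {homo p : x y / x <= y},
        injective i /\ range p = [set: K],
        range i = [set y | p y = 0],
        i @^-1` pos_cone H = pos_cone G /\ p @` pos_cone H = pos_cone K &
        p u = v /\ i @^-1` order_interval u = D]].

Lemma og_addr_ge0 G (x y : G) : 0 <= x -> 0 <= y -> 0 <= x + y.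
Proof. by move=> x0 /(og_lerD2r x); rewrite add0r addrC; apply: le_trans. Qed.

Lemma og_sum_ge0 G I (r : seq I) (F : I -> G) :
  (forall i, 0 <= F i) -> 0 <= \sum_(i <- r) F i.
Proof. by move=> F0; elim/big_ind: _ => //; apply: og_addr_ge0. Qed.

Lemma og_scale_ge0 G (a : group_ring Gamma) (x : G) :
  gr_pos a -> 0 <= x -> 0 <= a *: x.
Proof.
move=> a0 x0; have -> : a *: x = \sum_(k <- msupp a) gr_of k *: x *+ `|a@_k|%N.
  rewrite {1}(_ : a = \sum_(k <- msupp a) (gr_of k *+ `|a@_k|%N)).
    by rewrite scaler_suml; apply/eq_bigr => k _; rewrite scalerMnl.
  rewrite [LHS]monalgE; apply/eq_bigr => k _.
  have := a0 k; rewrite /gr_of; case: (mcoeff k a) => // n _.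
  apply/malgP => l; rewrite mcoeffMn !mcoeffU /=.
  by case: eqP => _; rewrite ?mulr0n ?mul0rn // !mulr1n natz.
apply: og_sum_ge0 => k; have kx0 : 0 <= gr_of k *: x.
  by rewrite -(scaler0 _ (gr_of k)); apply: og_lerZ.
by elim: `|_|%N => [|n IH]; rewrite ?mulr0n // mulrS; apply: og_addr_ge0.
Qed.

Lemma order_unit_directed G (u : G) : order_unit u -> directed G.
Proof.
move=> [u0 bound] x y.
have [[a [a0 _ xa]] [b [b0 _ yb]]] := (bound x, bound y).
exists (a *: u + b *: u); split.
  apply: (le_trans xa); rewrite addrC -[leLHS]add0r.
  by apply: og_lerD2r; apply: og_scale_ge0.
apply: (le_trans yb); rewrite -[leLHS]add0r.
by apply: og_lerD2r; apply: og_scale_ge0.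
Qed.

End OrderedGammaGroups.

Arguments pos_cone {Gamma} G.
Arguments directed {Gamma} G.
Arguments stab {Gamma} G.
Arguments SDP {Gamma} Delta G.
Arguments dimension_group {Gamma} G.

(* Main.v *)
Require Import Defs.
From HB Require Import structures.
From mathcomp Require Import all_boot all_order all_algebra.
From mathcomp Require Import boolp classical_sets.
From mathcomp Require Import finmap monalg.

Set Implicit Arguments.
Unset Strict Implicit.
Unset Printing Implicit Defensive.

Import Order.TTheory GRing.Theory Num.Theory.

Local Open Scope classical_set_scope.
Local Open Scope ring_scope.

(** Write N for the normal closure of Delta and pi for the projection of
    Z[Gamma] onto Z[Gamma / N].  The module Z[Gamma / N] acts on G, in the
    sense that a *: x depends only on pi a (perm_proj_act), because N
    stabilises G.  The extension is the module H = G * Z[Gamma / N] with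
    unit u = (0, N), ordered so that - d + u is positive for every d in D and
    nothing more is forced: (x, f) is positive when f = pi b for some b in
    Z^+[Gamma] and x + b *: d is nonnegative for some d in D.  Directedness of
    D makes this a cone; convexity of D gives i^-1([0, u]) = D; the spanning
    property of D, together with directedness of G, makes u an order-unit.

    SDP passes from G to H (extension_SDP).  Let the relation be given by
    coefficients a_i and positive elements z_i = (x_i, pi b_i), and choose one
    d in D that works for all of them.  Then
      z_i = (x_i + b_i *: d, 0) + b_i *: (- d, N).
    The second coordinates of the relation say that the sum of the pi (a_i b_i)
    vanishes, so the elements b_i *: d satisfy the relation in G, hence so do
    the positive elements x_i + b_i *: d.  SDP in G decomposes these, and
    adjoining the single generator (- d, N), with coefficients b_i,
    decomposes the z_i.

    Since pi_Delta a = 0 implies pi a = 0, SDP for Delta implies SDP for N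
    (SDP_sub); and N stabilises Z[Gamma / N] because it is normal, so it
    stabilises H. *)

(** * Positive elements of the group ring *)

Lemma malg_basisMz (T : choiceType) (x : T) (m : int) :
  << m *g x >> = << x >> *~ m :> {malg int[T]}.
Proof. by rewrite -[in LHS](intz m) raddfMz. Qed.

Lemma mcoeff_basisMz (T : choiceType) (x y : T) (m : int) :
  mcoeff y (<< x >> *~ m : {malg int[T]}) = m *+ (x == y).
Proof. by rewrite -malg_basisMz mcoeffU. Qed.

Section GroupRingPositivity.
Context {Gamma : groupType}.
Implicit Types (a b : group_ring Gamma) (g h : Gamma).

Lemma gr_ofM g h : gr_of g * gr_of h = gr_of (g * h)%g.
Proof. by rewrite /GRing.mul /= /gr_mul convUU mulr1. Qed.

Lemma gr_sumE a : a = \sum_(k <- msupp a) gr_of k *~ mcoeff k a.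
Proof.
rewrite [LHS]monalgE; apply: eq_bigr => k _.
exact: malg_basisMz.
Qed.

Lemma gr_pos_of g : gr_pos (gr_of g).
Proof. by move=> h; rewrite mcoeffU; case: eqP. Qed.

Lemma gr_pos0 : gr_pos (0 : group_ring Gamma).
Proof. by move=> h; rewrite mcoeff0. Qed.

Lemma gr_posD a b : gr_pos a -> gr_pos b -> gr_pos (a + b).
Proof. by move=> a0 b0 h; rewrite mcoeffD addr_ge0 ?a0 ?b0. Qed.

Lemma gr_pos_sum I (r : seq I) (F : I -> group_ring Gamma) :
  (forall i, gr_pos (F i)) -> gr_pos (\sum_(i <- r) F i).
Proof.
by move=> F0; elim/big_ind: _ => //; [exact: gr_pos0 | exact: gr_posD].
Qed.

Lemma gr_posMn a n : gr_pos a -> gr_pos (a *+ n).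
Proof. by move=> a0 h; rewrite mcoeffMn mulrn_wge0 ?a0. Qed.

Lemma gr_pos_gr_ofM g b : gr_pos b -> gr_pos (gr_of g * b).
Proof.
move=> b0; rewrite (gr_sumE b) mulr_sumr.
apply: gr_pos_sum => k; have := b0 k; case: (mcoeff k b) => // n _.
by rewrite -pmulrn mulrnAr gr_ofM; apply/gr_posMn/gr_pos_of.
Qed.

(** The positive cone of the group ring is pointed. *)
Lemma gr_posD_eq0 a b : gr_pos a -> gr_pos b -> a + b = 0 -> a = 0.
Proof.
move=> a0 b0 ab0; apply/malgP => k; apply/eqP; rewrite mcoeff0 eq_le a0 andbT.
have -> : a = - b by apply/eqP; rewrite -addr_eq0 ab0.
by rewrite mcoeffN oppr_le0 b0.
Qed.

End GroupRingPositivity.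

(** * Permutation modules *)

Section Cosets.
Context {Gamma : groupType} (A : set Gamma).
Implicit Types (a b : group_ring Gamma) (C : lcoset A) (f : perm_module A).

Lemma lcoset_of_surj C : exists g, lcoset_of A g = C.
Proof.
by case: C => C CA; case: (set_mem CA) => g _ gC; exists g; apply: val_inj.
Qed.

Lemma lcoset_act_of g h : lcoset_act g (lcoset_of A h) = lcoset_of A (g * h)%g.
Proof. by apply: val_inj; rewrite /= translateM. Qed.

Lemma perm_scale_of g h (f := << lcoset_of A h >> : perm_module A) :
  gr_of g *: f = << lcoset_of A (g * h)%g >>.
Proof. by rewrite /GRing.scale /= /perm_scale convUU mulr1 lcoset_act_of. Qed.

Lemma perm_proj_of g : perm_proj A (gr_of g) = << lcoset_of A g >>.
Proof. by rewrite /perm_proj perm_scale_of mulg1. Qed.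

Lemma perm_projD a b : perm_proj A (a + b) = perm_proj A a + perm_proj A b.
Proof. exact: scalerDl. Qed.

Lemma perm_projM a b : perm_proj A (a * b) = a *: perm_proj A b.
Proof. by rewrite /perm_proj scalerA. Qed.

Lemma perm_proj_sum I (r : seq I) (F : I -> group_ring Gamma) :
  perm_proj A (\sum_(i <- r) F i) = \sum_(i <- r) perm_proj A (F i).
Proof. exact: scaler_suml. Qed.

Lemma perm_projMz a m : perm_proj A (a *~ m) = perm_proj A a *~ m.
Proof. by rewrite /perm_proj scalerMzl. Qed.

Lemma mcoeff_perm_proj a C :
  mcoeff C (perm_proj A a) =
  \sum_(k <- msupp a) mcoeff k a *+ (lcoset_of A k == C).
Proof.
rewrite [in LHS](gr_sumE a) perm_proj_sum raddf_sum; apply: eq_bigr => k _.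
rewrite perm_projMz perm_proj_of; apply: mcoeff_basisMz.
Qed.

Lemma perm_unit_ge0 : 0 <= perm_unit A.
Proof. by apply/perm_leP => C; rewrite mcoeff0 mcoeffU; case: eqP. Qed.

Lemma perm_proj_ge0 a : gr_pos a -> 0 <= perm_proj A a.
Proof. by move=> a0; apply: og_scale_ge0 => //; apply: perm_unit_ge0. Qed.

(** Positive coefficients cannot cancel within a coset: each coefficient of
    pi a is a sum of coefficients of a, and a sum of nonnegative integers
    vanishes only termwise. *)
Lemma perm_proj_eq0 a : gr_pos a -> perm_proj A a = 0 -> a = 0.
Proof.
move=> a0 pa0; apply/malgP => k; rewrite mcoeff0; apply: contrapT => /eqP ak.
have /esym := mcoeff_perm_proj a (lcoset_of A k).
rewrite pa0 mcoeff0 => /eqP; rewrite psumr_eq0; last first.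
  by move=> l _; rewrite mulrn_wge0 ?a0.
move=> /allP /(_ k); rewrite mcoeff_neq0 in ak; move=> /(_ ak).
by rewrite eqxx mulr1n mcoeff_eq0 ak.
Qed.

Lemma perm_sumE f : f = \sum_(C <- msupp f) << C >> *~ mcoeff C f.
Proof.
rewrite [LHS]monalgE; apply: eq_bigr => C _.
exact: malg_basisMz.
Qed.

(** A lift is obtained by choosing a representative in each coset. *)
Lemma perm_proj_lift f : 0 <= f -> exists2 b, gr_pos b & perm_proj A b = f.
Proof.
move=> /perm_leP f0; have [r rE] := choice lcoset_of_surj.
exists (\sum_(C <- msupp f) gr_of (r C) *~ mcoeff C f).
  apply: gr_pos_sum => C; have := f0 C; rewrite mcoeff0.
  by case: (mcoeff C f) => // n _; apply/gr_posMn/gr_pos_of.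
rewrite perm_proj_sum [RHS]perm_sumE; apply: eq_bigr => C _.
by rewrite perm_projMz perm_proj_of rE.
Qed.

Lemma perm_unit_order_unit : order_unit (perm_unit A).
Proof.
split=> [|f]; first exact: perm_unit_ge0.
(* Replace the coefficients of f by their absolute values and lift; adding 1
   to the lift keeps it nonzero when f = 0. *)
have [g g0 fg] : exists2 g : perm_module A, 0 <= g & f <= g.
  exists (\sum_(C <- msupp f) << C >> *~ `|mcoeff C f|).
    apply: og_sum_ge0 => C; apply/perm_leP => B.
    by rewrite mcoeff0 mcoeff_basisMz mulrn_wge0.
  apply/perm_leP => B; rewrite [in X in X <= _](perm_sumE f) !raddf_sum.
  apply: ler_sum => C _; rewrite /= !mcoeff_basisMz.
  by rewrite ler_wMn2r ?ler_norm.
have [b b0 bg] := perm_proj_lift g0.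
have b10 : gr_pos (1 + b) by apply: gr_posD => //; apply: gr_pos_of.
exists (1 + b); split => //.
  apply/eqP => /(gr_posD_eq0 (gr_pos_of _) b0) /eqP.
  by apply/negP; apply: oner_neq0.
rewrite -/(perm_proj A _) perm_projD bg; apply: (le_trans fg).
by rewrite -[X in X <= _]add0r og_lerD2r // perm_proj_ge0 //; apply: gr_pos_of.
Qed.

(** The orbit map k |-> k x factors through the cosets of A, so a *: x can be
    computed coset by coset, with the coefficients of pi_A a.  Only A x = x is
    asked, hence the lemma applies both to G and to Z[Gamma / B]. *)
Lemma perm_proj_ker (M : lmodType (group_ring Gamma)) (x : M) a :
  A 1%g -> (forall h, A h -> gr_of h *: x = x) ->
  perm_proj A a = 0 -> a *: x = 0.
Proof.
move=> A1 Ax pa0; have [r rE] := choice lcoset_of_surj.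
(* The orbit map only sees the chosen representative of the coset of k. *)
have orbE k : gr_of k *: x = gr_of (r (lcoset_of A k)) *: x.
  have /(congr1 (fun C : lcoset A => \val C)) /= := rE (lcoset_of A k).
  move: (r _) => l lk; have [h Ah <-] : translate l A k.
    by rewrite lk; exists 1%g; rewrite ?mulg1.
  by rewrite -gr_ofM -scalerA Ax.
pose S := undup [seq lcoset_of A k | k <- msupp a].
have -> : a *: x = \sum_(C <- S) (gr_of (r C) *: x) *~ mcoeff C (perm_proj A a).
  rewrite {1}(gr_sumE a) scaler_suml.
  under [RHS]eq_bigr do rewrite mcoeff_perm_proj mulrz_sumr.
  rewrite exchange_big /= big_seq [RHS]big_seq; apply: eq_bigr => k ka.
  rewrite (bigD1_seq (lcoset_of A k)) ?undup_uniq //=; last first.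
    by rewrite mem_undup map_f.
  rewrite eqxx mulr1n -orbE scalerMzl big1 ?addr0 // => C /negPf Ck.
  by rewrite eq_sym Ck mulr0n mulr0z.
by rewrite big1 // => C _; rewrite pa0 mcoeff0 mulr0z.
Qed.

End Cosets.

(** * Stabilisers and normal closures *)

Section Closures.
Context {Gamma : groupType}.
Implicit Types (A : set Gamma) (G : orderedGammaGroupType Gamma).

Lemma stab_normal G : normal_subgroup (stab G).
Proof.
have stabV h : stab G h -> stab G h^-1%g.
  by move=> hG x; rewrite -[in LHS](hG x) scalerA gr_ofM mulVg scale1r.
split=> [|g h hG x].
  split=> [|h k /set_mem hG /set_mem kG]; apply: mem_set => x.
    exact: scale1r.
  by rewrite -gr_ofM -scalerA stabV.
rewrite conjgE -!gr_ofM -!scalerA hG scalerA gr_ofM mulVg.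
exact: scale1r.
Qed.

Lemma normal_closure_normal A : normal_subgroup (normal_closure A).
Proof.
split=> [|g x Ax M MA]; last by have [[_ +] _] := MA; apply; apply: Ax.
split=> [|x y /set_mem Ax /set_mem Ay]; apply: mem_set => M MA.
  by have [[[+ _] _] _] := MA; apply: set_mem.
have [[[_ M_div] _] _] := MA.
by apply/set_mem/M_div; apply: mem_set; [apply: Ax | apply: Ay].
Qed.

Lemma sub_normal_closure A : A `<=` normal_closure A.
Proof. by move=> x Ax M [_]; apply. Qed.

Lemma normal_closure_stab A G : A `<=` stab G -> normal_closure A `<=` stab G.
Proof. by move=> AG h; apply; split=> //; apply: stab_normal. Qed.

(** h (k A) = k (h ^ k) A = k A for h in A. *)
Lemma normal_stab_perm_module A :
  normal_subgroup A -> A `<=` stab (perm_module A).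
Proof.
move=> [A_grp A_conj] h Ah.
have AM x y : A x -> A y -> A (x * y)%g.
  move=> /mem_set Ax /mem_set Ay; exact/set_mem/(group_closedM A_grp).
have AV x : A x -> A x^-1%g.
  by move=> /mem_set Ax; apply/set_mem/(group_closedV A_grp).
have hk k : lcoset_of A (h * k)%g = lcoset_of A k.
  apply: val_inj; rewrite /= eqEsubset; split=> _ [l Al <-].
    exists (h ^ k * l)%g; first by apply: AM => //; apply: A_conj.
    by rewrite conjgE !mulgA mulgV mul1g.
  exists (h^-1 ^ k * l)%g; first by apply: AM => //; apply/A_conj/AV.
  by rewrite conjgE !mulgA mulgK mulgV mul1g.
move=> f; rewrite [f in RHS]perm_sumE [f in LHS]perm_sumE scaler_sumr.
apply: eq_bigr => C _; have [k <-] := lcoset_of_surj C.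
by rewrite -scalerMzr perm_scale_of hk.
Qed.

(** SDP weakens as the subgroup grows: the map pi_B factors through pi_A, by
    perm_proj_ker applied to the coset B itself. *)
Lemma SDP_sub A B G :
  A 1%g -> A `<=` stab (perm_module B) -> SDP A G -> SDP B G.
Proof.
move=> A1 AB sdpA n a x x0 ax0.
have [m [b [y [m0 by0 xE ab0]]]] := sdpA n a x x0 ax0.
exists m, b, y; split=> // j.
rewrite -perm_proj_sum; apply: (perm_proj_ker A1) => [h /AB hB|].
  exact: hB.
by rewrite perm_proj_sum ab0.
Qed.

End Closures.

(** * Generating intervals *)

Section GeneratingIntervals.
Context {Gamma : groupType} (G : orderedGammaGroupType Gamma).

Lemma og_subr_ge0 (x y : G) : (0 <= y - x) = (x <= y).
Proof.
apply/idP/idP => [/(og_lerD2r x)|/(og_lerD2r (- x))].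
  by rewrite add0r subrK.
by rewrite subrr.
Qed.

Lemma og_lerD (x y z w : G) : x <= y -> z <= w -> x + z <= y + w.
Proof.
move=> xy zw; apply: (le_trans (og_lerD2r z _ _ xy)).
by rewrite ![y + _]addrC og_lerD2r.
Qed.

Lemma og_scale_le (a : group_ring Gamma) (x y : G) :
  gr_pos a -> x <= y -> a *: x <= a *: y.
Proof.
move=> a0 xy; rewrite -og_subr_ge0 -scalerBr.
by apply: og_scale_ge0 => //; rewrite og_subr_ge0.
Qed.

Variable D : set G.
Hypothesis genD : generating_interval D.

Lemma generating_interval_ub n (d : 'I_n -> G) :
  (forall i, D (d i)) -> exists e, D e /\ forall i, d i <= e.
Proof.
have [_ D0 dirD _ _] := genD.
elim: n d => [|n IH] d Dd; first by exists 0; split=> // -[].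
have [e [De de]] := IH (fun i => d (lift ord0 i)) (fun i => Dd _).
have [f [Df ef df]] := dirD e (d ord0) De (Dd _).
exists f; split=> // i; case: (unliftP ord0 i) => [j|] -> //.
exact: le_trans (de j) ef.
Qed.

(** G is directed, so x lies below some positive element; such an element is a
    sum of terms a_i *: d_i, and an upper bound e of the d_i in D gives the
    bound (sum of the a_i) *: e. *)
Lemma generating_interval_cofinal (x : G) : directed G ->
  exists b d, [/\ gr_pos b, D d & x <= b *: d].
Proof.
have [_ _ _ _ spanD] := genD => dirG.
have [y [xy y0]] := dirG x 0.
have [n [a [d [a0 Dd yE]]]] := spanD y y0.
have [e [De de]] := generating_interval_ub Dd.
exists (\sum_i a i), e; split=> //; first exact: gr_pos_sum.
apply: (le_trans xy); rewrite yE scaler_suml.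
by elim/big_ind2: _ => // [u v w t|i _]; [apply: og_lerD | apply: og_scale_le].
Qed.

End GeneratingIntervals.

(** * The extension attached to a generating interval *)

Section Extension.
Context {Gamma : groupType} (G : orderedGammaGroupType Gamma) (N : set Gamma).
Variable D : set G.
Hypothesis genD : generating_interval D.

(** The order, unlike the module, depends on D, and its transitivity rests on D
    being directed; the proof genD is therefore a parameter of the type, from
    which the instances below recover it. *)
Definition extension of generating_interval D : Type :=
  (G * perm_module N)%type.
Local Notation H := (extension genD).

HB.instance Definition _ := GRing.Lmodule.on H.

(** The cone is stated with a lift b of the second coordinate so that b can act
    on G.  Existence of one lift is enough for the order axioms; independence of
    the lift (perm_proj_act) holds when N stabilises G. *)
Definition ext_pos : set H := [set z |
  exists b d, [/\ gr_pos b, D d, perm_proj N b = z.2 & 0 <= z.1 + b *: d]].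

Definition ext_le (z w : H) : bool := `[< ext_pos (w - z) >].

(** An upper bound in D of the two witnesses is a witness for the sum. *)
Lemma ext_posD z w : ext_pos z -> ext_pos w -> ext_pos (z + w).
Proof.
move=> [b [d [b0 Dd bz zd]]] [c [e [c0 De cw we]]].
have [_ _ dirD _ _] := genD; have [f [Df df ef]] := dirD d e Dd De.
exists (b + c), f; split=> //; first exact: gr_posD.
  by rewrite perm_projD bz cw.
rewrite scalerDl addrACA; apply: og_addr_ge0.
  by apply: (le_trans zd); apply: og_lerD; rewrite // og_scale_le.
by apply: (le_trans we); apply: og_lerD; rewrite // og_scale_le.
Qed.

Lemma ext_le_refl : reflexive ext_le.
Proof.
have [_ D0 _ _ _] := genD.
move=> z; apply/asboolP; rewrite subrr; exists 0, 0; split=> //.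
- exact: gr_pos0.
- exact: scale0r.
- by rewrite scale0r addr0.
Qed.

(** If w - z and z - w are positive with lifts b and c, then pi (b + c) = 0, so
    b = c = 0 and the comparison takes place in G. *)
Lemma ext_le_anti : antisymmetric ext_le.
Proof.
move=> z w /andP[/asboolP[b [d [b0 Dd bE zd]]] /asboolP[c [e [c0 De cE we]]]].
have bc0 : b + c = 0.
  apply: (@perm_proj_eq0 _ N); first exact: gr_posD.
  by rewrite perm_projD bE cE /= addrC subrKA subrr.
have b_eq0 := gr_posD_eq0 b0 c0 bc0.
have c_eq0 : c = 0 by move: bc0; rewrite b_eq0 add0r.
move: bE cE zd we; rewrite {}b_eq0 {}c_eq0 !scale0r !addr0 /= => bE _ wz zw.
have zw1 : z.1 = w.1.
  by apply/le_anti/andP; split; rewrite -og_subr_ge0; [exact: wz | exact: zw].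
have zw2 : z.2 = w.2.
  by apply/eqP; rewrite eq_sym -subr_eq0 -bE; apply/eqP; apply: scale0r.
by case: z w zw1 zw2 {bE wz zw} => [z1 z2] [w1 w2] /= -> ->.
Qed.

Lemma ext_le_trans : transitive ext_le.
Proof.
move=> w z v /asboolP zw /asboolP wv; apply/asboolP.
by rewrite -(subrKA w v) addrC; apply: ext_posD; rewrite // addrC.
Qed.

HB.instance Definition _ := Order.Le_isPOrder.Build ring_display H
  ext_le_refl ext_le_anti ext_le_trans.

Lemma ext_leP (z w : H) : reflect (ext_pos (w - z)) (z <= w).
Proof. exact: asboolP. Qed.

Lemma ext_ge0P (z : H) : reflect (ext_pos z) (0 <= z).
Proof. by apply: (iffP (ext_leP 0 z)); rewrite subr0. Qed.

Lemma ext_lerD2r (v z w : H) : z <= w -> z + v <= w + v.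
Proof.
by move=> /ext_leP zw; apply/ext_leP; rewrite opprD addrACA subrr addr0.
Qed.

Lemma ext_lerZ (g : Gamma) (z w : H) : z <= w -> gr_of g *: z <= gr_of g *: w.
Proof.
move=> /ext_leP[b [d [b0 Dd bE zw]]]; apply/ext_leP; rewrite -scalerBr.
exists (gr_of g * b), d; split.
- exact: gr_pos_gr_ofM.
- exact: Dd.
- by rewrite perm_projM bE.
- rewrite -scalerA -[X in X + _]/(gr_of g *: (w - z).1) -scalerDr.
  by rewrite -(scaler0 _ (gr_of g)); apply: og_lerZ.
Qed.

HB.instance Definition _ := isOrderedGammaGroup.Build Gamma H
  ext_lerD2r ext_lerZ.

Definition ext_in (x : G) : H := (x, 0).

Lemma ext_in_linear : linear ext_in.
Proof.
move=> a x y; congr pair.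
by rewrite -[RHS]/(a *: (0 : perm_module N) + 0) scaler0 addr0.
Qed.

HB.instance Definition _ :=
  GRing.isLinear.Build (group_ring Gamma) G H _ ext_in ext_in_linear.

Definition ext_out (z : H) : perm_module N := z.2.

Lemma ext_out_linear : linear ext_out.
Proof. by []. Qed.

HB.instance Definition _ :=
  GRing.isLinear.Build (group_ring Gamma) H (perm_module N) _ ext_out
    ext_out_linear.

Definition ext_unit : H := (0, perm_unit N).

Lemma ext_in_ge0 (x : G) : (0 <= ext_in x) = (0 <= x).
Proof.
have [_ D0 _ _ _] := genD.
apply/ext_ge0P/idP => [[b [d [b0 _ bE]]]|x0].
  by rewrite (perm_proj_eq0 b0 bE) scale0r addr0.
exists 0, 0; split; [exact: gr_pos0 | exact: D0 | exact: scale0r |].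
by rewrite scaler0 addr0.
Qed.

Lemma ext_out_ge0 (z : H) : 0 <= z -> 0 <= ext_out z.
Proof.
by move=> /ext_ge0P[b [d [b0 _ bE _]]]; rewrite /ext_out -bE perm_proj_ge0.
Qed.

Lemma ext_pair_ge0 (b : group_ring Gamma) (d x : G) :
  gr_pos b -> D d -> 0 <= x + b *: d -> 0 <= ((x, perm_proj N b) : H).
Proof. by move=> b0 Dd xd; apply/ext_ge0P; exists b, d. Qed.

Hypothesis N1 : N 1%g.
Hypothesis NG : N `<=` stab G.

Lemma perm_proj_act (a b : group_ring Gamma) (x : G) :
  perm_proj N a = perm_proj N b -> a *: x = b *: x.
Proof.
move=> abE; apply/eqP; rewrite -subr_eq0 -scalerBl; apply/eqP.
apply: (perm_proj_ker N1) => [h /NG hG|]; first exact: hG.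
rewrite /perm_proj scalerBl; apply/eqP; rewrite subr_eq0; exact/eqP.
Qed.

(** Any lift of the coset N acts as 1, so x <= u says that x <= d for some d
    in D; convexity then puts x in D. *)
Lemma ext_in_le_unit (x : G) : 0 <= x -> (ext_in x <= ext_unit) <-> D x.
Proof.
have [_ D0 _ convD _] := genD => x0.
have unit1 : perm_proj N 1 = perm_unit N by exact: scale1r.
split=> [/ext_leP[b [d [b0 Dd bE]]]|Dx].
  rewrite /= sub0r (@perm_proj_act b 1) ?scale1r => [xd|]; last first.
    by rewrite unit1 bE /= subr0.
  apply: (convD _ _ _ D0 Dd x0).
  by rewrite -og_subr_ge0 addrC.
apply/ext_leP; exists 1, x; split; [exact: gr_pos_of | exact: Dx | |].
  by rewrite unit1 /= subr0.
by rewrite /= sub0r scale1r addNr.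
Qed.

(** If f <= b *: N and x <= c *: d with d in D, then (x, f) <= (b + c) *: u:
    the multiple b takes care of f, and c *: u exceeds c *: d. *)
Lemma ext_unit_order_unit : directed G -> order_unit ext_unit.
Proof.
have [_ D0 _ _ _] := genD => dirG; split.
  rewrite /ext_unit -[perm_unit N]scale1r.
  apply: (ext_pair_ge0 (gr_pos_of _) D0).
  by rewrite scaler0 addr0.
case=> x f.
have [_ /(_ f)[b [b0 b_neq0 fb]]] := perm_unit_order_unit N.
have [c [d [c0 Dd xc]]] := generating_interval_cofinal genD x dirG.
exists (b + c); split; first exact: gr_posD.
  by apply/eqP => /(gr_posD_eq0 b0 c0)/eqP; apply/negP.
have [e e0 eE] : exists2 e, gr_pos e & perm_proj N e = b *: perm_unit N - f.
  apply: perm_proj_lift.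
  by rewrite og_subr_ge0.
apply/ext_leP; exists (e + c), d; split; [exact: gr_posD | exact: Dd | |].
  by rewrite perm_projD eE /= scalerDl addrAC.
rewrite /= scaler0 sub0r scalerDl addrCA; apply: og_addr_ge0.
  apply: og_scale_ge0 => //; have [+ _ _ _ _] := genD; exact.
by rewrite addrC og_subr_ge0.
Qed.

Lemma extension_is_extension :
  directed G -> is_extension D (perm_unit N) ext_unit.
Proof.
move=> dirG; split=> //; first exact: ext_unit_order_unit.
  exact: perm_unit_order_unit.
exists ext_in, ext_out; split.
- split=> [x y xy|z w zw].
    by rewrite -og_subr_ge0 -linearB ext_in_ge0 og_subr_ge0.
  by rewrite -og_subr_ge0 -linearB ext_out_ge0 // og_subr_ge0.
- split=> [x y [] //|]; apply/seteqP; split=> // f _.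
  by exists (0, f).
- apply/seteqP; split=> [_ [x _ <-] //|[x f] /= f0].
  by exists x => //; rewrite /ext_in -f0.
- split; first by apply/seteqP; split=> x; rewrite /pos_cone /= ext_in_ge0.
  apply/seteqP; split=> [_ [z z0 <-]|f f0]; first exact: ext_out_ge0.
  have [b b0 bE] := perm_proj_lift f0; have [_ D0 _ _ _] := genD.
  exists (0, f) => //; rewrite /pos_cone /= -bE.
  by apply: (ext_pair_ge0 b0 D0); rewrite scaler0 addr0.
- split=> //; apply/seteqP; split=> x.
    rewrite /order_interval /= => /andP[]; rewrite ext_in_ge0 => x0.
    by move/(ext_in_le_unit x0).
  move=> Dx; have [Dpos _ _ _ _] := genD; have x0 : 0 <= x := Dpos _ Dx.
  by apply/andP; split; [rewrite ext_in_ge0 | apply/(ext_in_le_unit x0)].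
Qed.

(** Subtracting multiples of (- d, N) moves the relation into G. *)
Lemma extension_SDP : SDP N G -> SDP N H.
Proof.
move=> sdpG n a z z0 az0.
have z_pos i : exists bd : group_ring Gamma * G,
    [/\ gr_pos bd.1, D bd.2, perm_proj N bd.1 = (z i).2
       & 0 <= (z i).1 + bd.1 *: bd.2].
  by have /ext_ge0P[b [d ?]] := z0 i; exists (b, d).
have [bd bdP] := choice z_pos.
pose c i := (bd i).1.
have Dbd i : D (bd i).2 by have [] := bdP i.
have [d [Dd dP]] := generating_interval_ub genD Dbd.
pose x i := (z i).1 + c i *: d.
have x0 i : 0 <= x i.
  have [c0 _ _ ci] := bdP i; apply: (le_trans ci).
  by apply: og_lerD; rewrite // og_scale_le.
have az1 : \sum_i a i *: (z i).1 = 0.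
  transitivity (\sum_i a i *: z i).1; last by rewrite az0.
  by apply: (big_ind2 (fun x (w : H) => x = w.1)) => // x1 w1 x2 w2 -> ->.
have ac0 : \sum_i perm_proj N (a i * c i) = 0.
  transitivity (ext_out (\sum_i a i *: z i)); last by rewrite az0 linear0.
  rewrite linear_sum; apply: eq_bigr => i _; have [_ _ cE _] := bdP i.
  by rewrite perm_projM cE linearZ.
have ax0 : \sum_i a i *: x i = 0.
  under eq_bigr do rewrite scalerDr scalerA.
  rewrite big_split /= az1 add0r -scaler_suml -(scale0r d).
  apply: perm_proj_act; rewrite perm_proj_sum ac0.
  exact/esym/scale0r.
have [m [b [y [m0 [b0 y0] xE ab0]]]] := sdpG n a x x0 ax0.
(* The generator of index 0 is (- d, N); the others come from G. *)
exists m.+1, (fun i j => if unlift ord0 j is Some k then b i k else c i).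
exists (fun j =>
  if unlift ord0 j is Some k then ext_in (y k) else (- d, perm_unit N)).
split=> //.
- split=> [i j|j]; case: unliftP => [k _|_] //.
  + by have [] := bdP i.
  + by rewrite ext_in_ge0.
  + rewrite -[perm_unit N]scale1r; apply: (ext_pair_ge0 (gr_pos_of _) Dd).
    by rewrite [X in _ + X]scale1r addNr.
- move=> i; rewrite big_ord_recl unlift_none.
  under eq_bigr do rewrite liftK -linearZ.
  rewrite -linear_sum -xE (surjective_pairing (z i)); congr pair.
    by rewrite -[RHS]/(c i *: - d + x i) /x scalerN addrCA addNr addr0.
  have [_ _ cE _] := bdP i.
  by rewrite -cE; apply/esym/addr0.
- move=> j; case: unliftP => [k _|_]; [exact: ab0 | exact: ac0].
Qed.

Lemma ext_stab : N `<=` stab (perm_module N) -> N `<=` stab H.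
Proof.
move=> NN h Nh [x f]; congr pair; [exact: NG | exact: NN].
Qed.

End Extension.

Theorem theoremB4 (Gamma : groupType) (G : orderedGammaGroupType Gamma)
    (D : set G) (Delta : set Gamma) :
  noetherian (group_ring Gamma) ->
  dimension_group G ->
  generating_interval D ->
  subgroup Delta -> Delta `<=` stab G -> SDP Delta G ->
  exists (H : orderedGammaGroupType Gamma) (u : H),
    [/\ is_extension D (perm_unit (normal_closure Delta)) u,
        SDP (normal_closure Delta) H &
        normal_closure Delta `<=` stab H].
Proof.
move=> _ [dirG _] genD [/set_mem Delta1 _] DeltaG sdpG.
have subN := @sub_normal_closure _ Delta.
have NG := normal_closure_stab DeltaG.
have NN := normal_stab_perm_module (normal_closure_normal Delta).
have N1 := subN _ Delta1.
exists (extension (normal_closure Delta) genD), (ext_unit _ genD); split.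
- exact: extension_is_extension.
- apply: extension_SDP => //.
  by apply: SDP_sub sdpG => // h /subN; apply: NN.
- exact: ext_stab.
Qed.
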